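(* Let $\Delta$ be a $(d-1)$-dimensional simplicial complex whose $h$-vector $h(\Delta)=(h_0(\Delta),\ldots,h_d(\Delta))$ is non-negative (i.e. $h_i(\Delta)\ge 0$ for all $0\le i\le d$). Then the $h$-polynomial of its interval subdivision, $$h(\mathrm{Int}(\Delta),t)=\sum_{i=0}^{d}h_i(\mathrm{Int}(\Delta))\,t^i,$$ has only real roots. In particular, $h(\mathrm{Int}(\Delta),t)$ is log-concave, and hence unimodal.
   Context: Simplicial complexes are finite abstract simplicial complexes on a ground set $[n]=\{1,\ldots,n\}$, containing the empty face $\emptyset$ (of dimension $-1$). For a $(d-1)$-dimensional simplicial complex $\Delta$, $f_i(\Delta)$ is the number of $i$-dimensional faces ($f_{-1}(\Delta)=1$), and the $h$-vector $(h_0(\Delta),\ldots,h_d(\Delta))$ is defined by $h_k(\Delta)=\sum_{i=0}^{k}(-1)^{k-i}\binom{d-i}{k-i}f_{i-1}(\Delta)$. Interval subdivision: let $I(\Delta\setminus\{\emptyset\})=\{[A,B] : \emptyset\ne A\subseteq B\in\Delta\}$, partially ordered by $[A,B]\subseteq[A',B']$ iff $A'\subseteq A\subseteq B\subseteq B'$. Then $\mathrm{Int}(\Delta)$ is the simplicial complex on the ground set $I(\Delta\setminus\{\emptyset\})$ whose faces are all chains of this poset; an $l$-dimensional face is a strict chain $[A_0,B_0]\subset\cdots\subset[A_l,B_l]$. $\mathrm{Int}(\Delta)$ is again $(d-1)$-dimensional. A polynomial $p(x)=\sum_{i=0}^d a_ix^i$ with real coefficients is unimodal if there is $j$ with $a_0\le\cdots\le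 a_j\ge a_{j+1}\ge\cdots\ge a_d$, and log-concave if $a_i^2\ge a_{i-1}a_{i+1}$ for $1\le i\le d-1$. *)

(* Defs.v *)
From mathcomp Require Import all_boot all_order all_algebra.
From mathcomp Require Import reals complex.

Set Implicit Arguments.
Unset Strict Implicit.
Unset Printing Implicit Defensive.

Import Order.TTheory GRing.Theory Num.Theory.
Local Open Scope ring_scope.

(* The ground set is a subset of the finite type V; points of V need not be
   vertices of the complex. *)
Definition simplicial_complex (V : finType) (D : {set {set V}}) : Prop :=
  set0 \in D /\ forall A B : {set V}, A \subset B -> B \in D -> A \in D.

Definition face_dim (V : finType) (F : {set V}) : int := #|F|%:Z - 1.

(* One more than the dimension, i.e. the d of a (d-1)-dimensional complex. *)
Definition rank (V : finType) (D : {set {set V}}) : nat :=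
  \max_(F in D) #|F|.

Definition complex_dim (V : finType) (D : {set {set V}}) : int :=
  (rank D)%:Z - 1.

Definition fvec (V : finType) (D : {set {set V}}) (i : int) : nat :=
  #|[set F in D | face_dim F == i]|.

Definition hvec (V : finType) (D : {set {set V}}) (k : nat) : int :=
  \sum_(i < k.+1)
    (-1) ^+ (k - i) * ('C(rank D - i, k - i))%:Z * (fvec D (i%:Z - 1))%:Z.

(* The interval [A, B] is encoded as the pair (A, B). *)
Definition intervals (V : finType) (D : {set {set V}}) :
    {set {set V} * {set V}} :=
  [set I : {set V} * {set V} | [&& I.1 != set0, I.1 \subset I.2 & I.2 \in D]].

Definition interval_le (V : finType) (I J : {set V} * {set V}) : bool :=
  (J.1 \subset I.1) && (I.2 \subset J.2).

Definition interval_subdivision (V : finType) (D : {set {set V}}) :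
    {set {set ({set V} * {set V})}} :=
  [set C : {set ({set V} * {set V})} | (C \subset intervals D) &&
     [forall I in C, forall J in C, interval_le I J || interval_le J I]].

Lemma interval_subdivision_complex (V : finType) (D : {set {set V}}) :
  simplicial_complex (interval_subdivision D).
Proof.
split=> [|A B sAB].
  by rewrite inE sub0set; apply/forall_inP => I; rewrite inE.
rewrite !inE => /andP[sBD /forall_inP chB]; rewrite (subset_trans sAB sBD) /=.
apply/forall_inP => I IA; apply/forall_inP => J JA.
by move/forall_inP: (chB _ (subsetP sAB _ IA)); apply; apply: (subsetP sAB).
Qed.

Definition real_rooted (R : realType) (p : {poly R}) : Prop :=
  forall z : complex R, root (map_poly (real_complex R) p) z -> z \is Num.real.

(* For the next two notions p is read as \sum_(i <= d) p`_i 'X^i; the top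
   coefficients may vanish, so d is not determined by p. *)
Definition log_concave (R : realType) (d : nat) (p : {poly R}) : Prop :=
  forall i : nat, (0 < i < d)%N -> p`_i.-1 * p`_i.+1 <= p`_i ^+ 2.

Definition unimodal (R : realType) (d : nat) (p : {poly R}) : Prop :=
  exists2 j : nat, (j <= d)%N &
    (forall i : nat, (i < j)%N -> p`_i <= p`_i.+1) /\
    (forall i : nat, (j <= i < d)%N -> p`_i.+1 <= p`_i).

Definition hpoly (R : realType) (V : finType) (D : {set {set V}}) : {poly R} :=
  \sum_(i < (rank D).+1) (hvec D i)%:~R *: 'X^i.

(* Main.v *)
From HB Require Import structures.
Require Import Defs.
From mathcomp Require Import all_boot all_order all_algebra.
From mathcomp Require Import reals complex.
From mathcomp Require Import ring.
Import Order.TTheory GRing.Theory Num.Theory.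
Local Open Scope ring_scope.

Set Implicit Arguments.
Unset Strict Implicit.
Unset Printing Implicit Defensive.

(** The proof rests on one identity.  Write d for the rank of D and
    W := \sum_(j <= d) h_j(D) A_(d,j), where A_(d,j) is the polynomial with
    \sum_n n^j (n+1)^(d-j) x^n = A_(d,j)(x) / (1-x)^(d+1); W is the
    h-polynomial of the barycentric subdivision of D.  Then h(Int D, x^2) is the
    even part of (1 + x)^d W(x) ([hpoly_interval_even_part]):
      2 h(Int D, x^2) = (1 + x)^d W(x) + (1 - x)^d W(-x).

    Why this holds: a multichain of m intervals is a multichain of 2m non-empty
    faces, so the m-th coefficient of h(Int D, t) / (1-t)^d is p(2m) - p(2m-1)
    with p(n) := \sum_(F in D) n^#|F|, whereas W(x) / (1-x)^(d+1) is the
    generating series of p(n) itself.  Series are avoided: the functional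
    p |-> \sum_n p(n) x^n on polynomials makes sense for every x != 1 as an
    element of the field ([geom_sum]), it satisfies the expected shift rule
    ([geom_sum_shift]), and the generating function of the chains of intervals
    obeys the same recursion as \sum_m p(2m-1) x^(2m), by removal of the
    largest interval ([chain_sum_rec], [chain_sum_below_interval]).

    Roots of W: for z not real, the numbers A_(d,0)(z), ..., A_(d,d)(z),
    z A_(d,0)(z) turn in one direction and span an angle less than pi; the
    recursion of the A_(d,j) preserves this ([eulerian_interlace]).  A
    combination with coefficients h_j >= 0 and h_0 = 1 thus cannot vanish, and W
    has only negative real roots ([hpoly_sd_roots]).

    From W to Int D: if Re z > 0, each factor of G := (1 + x)^d W is larger in
    modulus at z than at -z, so G(z) + G(-z) != 0 ([even_part_neq0]).  A root
    t = z^2 of h(Int D, t) then has Re z = 0, that is t <= 0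
    ([hpoly_interval_roots]).

    Coefficients: a polynomial with non-positive roots and positive constant
    term is, up to a positive constant, a product of factors x + s with s >= 0,
    and multiplication by such a factor preserves
    a_i a_(j+2) <= a_(i+1) a_(j+1) for i <= j ([tp2_mulXsubC]).  This family of
    inequalities contains log-concavity, and it excludes internal zeros, so
    that unimodality follows. *)

(** * Eulerian polynomials off the real line *)

(** The recursion of the numerators A_(d,k) of \sum_n n^k (n+1)^(d-k) x^n,
    meant for k <= d; [geom_sum_eulerian] is the link with these series. *)
Fixpoint eulerian (K : nzRingType) (d k : nat) : {poly K} :=
  if d is e.+1 then
    \sum_(j < e.+1) (if (j < k)%N then 'X else 1) * eulerian K e j
  else 1.

Section Wedge.
Variable C : numClosedFieldType.
Implicit Types z u v : C.

(** Up to the factor 4, the product of Im z and Im (u^* v): for Im z > 0 it is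
    non-negative exactly when v lies at most a half-turn counterclockwise from
    u.  The factor Im z treats both half-planes at once. *)
Definition wedge z u v : C := (z^* - z) * (u^* * v - u * v^*).

Lemma wedge_suml z I (r : seq I) (P : pred I) (F : I -> C) v :
  wedge z (\sum_(i <- r | P i) F i) v = \sum_(i <- r | P i) wedge z (F i) v.
Proof.
by rewrite /wedge rmorph_sum !mulr_suml -sumrB mulr_sumr.
Qed.

Lemma wedge_sumr z I (r : seq I) (P : pred I) (F : I -> C) v :
  wedge z v (\sum_(i <- r | P i) F i) = \sum_(i <- r | P i) wedge z v (F i).
Proof.
by rewrite /wedge rmorph_sum !mulr_sumr -sumrB mulr_sumr.
Qed.

Lemma wedgeZl z c u v : c \is Num.real -> wedge z (c * u) v = c * wedge z u v.
Proof. by move=> cR; rewrite /wedge rmorphM /= (CrealP cR); ring. Qed.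

Lemma wedgeMM z a u v : wedge z (a * u) (a * v) = `|a| ^+ 2 * wedge z u v.
Proof. by rewrite normCK /wedge !rmorphM /=; ring. Qed.

Lemma wedge_mul z u : wedge z u (z * u) = (`|z - z^*| * `|u|) ^+ 2.
Proof.
by rewrite exprMn !normCK /wedge !rmorphM /= rmorphB /= conjCK; ring.
Qed.

Lemma wedge_mul_ge0 z u : 0 <= wedge z u (z * u).
Proof. by rewrite wedge_mul exprn_ge0 // mulr_ge0. Qed.

(** In the recursion for [eulerian], two entries i <= j of the next row have the
    form u + v and z u + v, where u collects the terms of index in [i, j[.  The
    next two identities express the wedges of these entries through wedges of
    the previous row. *)
Lemma wedge_swap_le z u v :
  wedge z (u + v) (z * u + v) = wedge z u (z * u) + wedge z u v + wedge z v (z * u).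
Proof. by rewrite /wedge !rmorphD !rmorphM /=; ring. Qed.

Lemma wedge_swap_wrap z u v :
  wedge z (z * u + v) (z * (u + v)) =
  wedge z v (z * v) + `|z| ^+ 2 * wedge z u v + wedge z v (z * u).
Proof. by rewrite normCK /wedge !(rmorphD, rmorphM) /=; ring. Qed.

Lemma horner_eulerianS z d k : (eulerian C d.+1 k).[z] =
  \sum_(j < d.+1) (if (j < k)%N then z else 1) * (eulerian C d j).[z].
Proof.
rewrite /= horner_sum; apply: eq_bigr => j _; rewrite hornerM.
by case: ifP; rewrite ?hornerX ?hornerC.
Qed.

(** The arguments of A_(d,0)(z), ..., A_(d,d)(z), z A_(d,0)(z) are monotone: this
    is interlacing, tested at a point off the real line. *)
Lemma eulerian_interlace z d i j : (i <= j <= d)%N ->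
  0 <= wedge z (eulerian C d i).[z] (eulerian C d j).[z] /\
  0 <= wedge z (eulerian C d j).[z] (z * (eulerian C d i).[z]).
Proof.
elim: d => [|d IHd] in i j *.
  move=> _; rewrite /= hornerC; split; last exact: wedge_mul_ge0.
  by rewrite /wedge mulr1 mul1r subrr mulr0.
case/andP=> le_ij le_jd.
pose a l := (eulerian C d l).[z].
(* Only the indices in mid carry different coefficients in the two sums. *)
pose mid (l : 'I_d.+1) := (i <= l < j)%N.
pose u := \sum_(l < d.+1 | mid l) a l.
pose v := \sum_(l < d.+1 | ~~ mid l) (if (l < i)%N then z else 1) * a l.
have -> : (eulerian C d.+1 i).[z] = u + v.
  rewrite horner_eulerianS (bigID mid) /=; congr (_ + _).
  by apply: eq_bigr => l /andP[il _]; rewrite ltnNge il mul1r.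
have -> : (eulerian C d.+1 j).[z] = z * u + v.
  rewrite horner_eulerianS (bigID mid) /= mulr_sumr; congr (_ + _).
    by apply: eq_bigr => l /andP[_ ->].
  apply: eq_bigr => l; rewrite negb_and -ltnNge -leqNgt.
  case/orP=> [li|jl]; first by rewrite li (leq_trans li).
  by rewrite !ltnNge jl (leq_trans le_ij jl).
have uv_ge0 : 0 <= wedge z u v.
  rewrite wedge_suml sumr_ge0 // => l /andP[il lj]; rewrite wedge_sumr sumr_ge0 // => m.
  rewrite negb_and -ltnNge -leqNgt; case/orP=> [mi|jm].
    by rewrite mi; apply: (IHd m l _).2; rewrite (leq_trans (ltnW mi) il) -ltnS /=.
  rewrite ltnNge (leq_trans le_ij jm) /= mul1r.
  by apply: (IHd l m _).1; rewrite (leq_trans (ltnW lj) jm) -ltnS /=.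
have vu_ge0 : 0 <= wedge z v (z * u).
  rewrite wedge_suml sumr_ge0 // => m nm; rewrite mulr_sumr wedge_sumr.
  rewrite sumr_ge0 // => l /andP[il lj].
  move: nm; rewrite negb_and -ltnNge -leqNgt; case/orP=> [mi|jm].
    rewrite mi wedgeMM mulr_ge0 ?exprn_ge0 //; apply: (IHd m l _).1.
    by rewrite (leq_trans (ltnW mi) il) -ltnS /=.
  rewrite ltnNge (leq_trans le_ij jm) /= mul1r.
  by apply: (IHd l m _).2; rewrite (leq_trans (ltnW lj) jm) -ltnS /=.
by rewrite wedge_swap_le wedge_swap_wrap; split;
  rewrite !addr_ge0 ?wedge_mul_ge0 // mulr_ge0 // exprn_ge0.
Qed.

(** Every term of the sum has a non-negative wedge with z A_(d,0)(z), and the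
    term of index 0 a positive one. *)
Lemma eulerian0_comb_neq0 z d (c : nat -> C) : z \isn't Num.real ->
    (forall j, (j <= d)%N -> 0 <= c j) -> 0 < c 0%N ->
  (eulerian C d 0).[z] != 0 ->
  \sum_(j < d.+1) c j * (eulerian C d j).[z] != 0.
Proof.
move=> zNR c_ge0 c0_gt0 A0; apply/negP => /eqP s0.
have: 0 < wedge z (\sum_(j < d.+1) c j * (eulerian C d j).[z])
               (z * (eulerian C d 0).[z]).
  rewrite wedge_suml big_ord_recl ltr_wpDr //.
    apply: sumr_ge0 => j _; have cj : 0 <= c (lift ord0 j) by rewrite c_ge0 // -ltnS.
    rewrite wedgeZl ?ger0_real // mulr_ge0 //.
    apply: (@eulerian_interlace z d 0%N (lift ord0 j) _).2.
    by rewrite leq0n -ltnS ltn_ord.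
  rewrite wedgeZl ?gtr0_real // mulr_gt0 // wedge_mul exprn_gt0 // mulr_gt0 ?normr_gt0 //.
  by rewrite subr_eq0; apply: contra zNR => /eqP zz; apply/CrealP.
by rewrite s0 /wedge !rmorph0 !mul0r subrr mulr0 ltxx.
Qed.

(** A_(d+1,0) is the sum of the A_(d,j), so the non-vanishing of A_(d,0)(z)
    follows by induction from the previous lemma. *)
Lemma eulerian_comb_neq0 z d (c : nat -> C) : z \isn't Num.real ->
    (forall j, (j <= d)%N -> 0 <= c j) -> 0 < c 0%N ->
  \sum_(j < d.+1) c j * (eulerian C d j).[z] != 0.
Proof.
move=> zNR c_ge0 c0_gt0; apply: eulerian0_comb_neq0 => //.
elim: d {c c_ge0 c0_gt0} => [|d IHd]; first by rewrite hornerC oner_neq0.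
by rewrite horner_eulerianS (@eulerian0_comb_neq0 _ _ (fun=> 1)).
Qed.

Lemma horner_eulerian_ge0 d k (x : C) : 0 <= x -> 0 <= (eulerian C d k).[x].
Proof.
move=> x_ge0; elim: d k => [|d IHd] k; first by rewrite hornerC.
by rewrite horner_eulerianS sumr_ge0 // => j _; rewrite mulr_ge0 //; case: ifP.
Qed.

Lemma horner_eulerian0_gt0 d (x : C) : 0 <= x -> 0 < (eulerian C d 0).[x].
Proof.
move=> x_ge0; elim: d => [|d IHd]; first by rewrite hornerC.
rewrite horner_eulerianS big_ord_recl ltr_wpDr // ?sumr_ge0 ?mul1r // => j _.
by rewrite mul1r horner_eulerian_ge0.
Qed.

(** On the closed positive half-line the value is positive because the A_(d,j)
    have non-negative coefficients. *)
Lemma eulerian_comb_roots d (c : nat -> C) :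
    (forall j, (j <= d)%N -> 0 <= c j) -> 0 < c 0%N ->
  forall z, root (\sum_(j < d.+1) c j *: eulerian C d j) z -> z < 0.
Proof.
move=> c_ge0 c0_gt0 z; rewrite rootE horner_sum.
under eq_bigr do rewrite hornerZ.
move=> s0; have zR : z \is Num.real.
  by apply: contraTT s0 => zNR; apply: eulerian_comb_neq0.
rewrite real_ltNge // ; apply: contraTN s0 => z_ge0.
rewrite gt_eqF // big_ord_recl ltr_wpDr ?mulr_gt0 ?horner_eulerian0_gt0 //.
by apply: sumr_ge0 => j _; rewrite mulr_ge0 ?horner_eulerian_ge0 ?c_ge0 // -ltnS.
Qed.
End Wedge.

(** * Power sums as linear functionals *)

(** The identity n^k (n+1)^(d+1-k) - n^(k+1) (n+1)^(d-k) = n^k (n+1)^(d-k), read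
    on numerators. *)
Lemma eulerian_step (K : comNzRingType) d k : (k <= d)%N ->
  eulerian K d.+1 k = eulerian K d.+1 k.+1 + (1 - 'X) * eulerian K d k.
Proof.
move=> le_kd; have kP : (k < d.+1)%N by [].
rewrite /= (bigD1 (Ordinal kP)) //= [in RHS](bigD1 (Ordinal kP)) //= ltnn ltnSn.
rewrite mul1r addrAC -mulrDl addrCA subrr addr0 mul1r; congr (_ + _).
apply: eq_bigr => j /negPf; rewrite -val_eqE /= => jk.
by rewrite [in RHS]ltnS [in RHS]leq_eqVlt jk.
Qed.

(** The series of n^(d+1) is x times that of (n+1)^(d+1). *)
Lemma eulerian_wrap (K : comNzRingType) d :
  eulerian K d.+1 d.+1 = 'X * eulerian K d.+1 0.
Proof. by rewrite /= mulr_sumr; apply: eq_bigr => j _; rewrite ltn_ord mul1r. Qed.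

Section GeomSum.
Variable F : fieldType.
Implicit Types (x : F) (p : {poly F}).

(** The value \sum_n p(n) x^n of the rational function that the series defines,
    extended linearly from p = 'X^b. *)
Definition geom_sum x p : F :=
  \sum_(b < size p) p`_b * ((eulerian F b b).[x] / (1 - x) ^+ b.+1).

(** A common range of summation, for comparing polynomials of different sizes. *)
Lemma geom_sum_widen x p n : (size p <= n)%N ->
  geom_sum x p = \sum_(b < n) p`_b * ((eulerian F b b).[x] / (1 - x) ^+ b.+1).
Proof.
move=> le_pn; pose u b := p`_b * ((eulerian F b b).[x] / (1 - x) ^+ b.+1).
rewrite /geom_sum -(big_mkord xpredT u) -[RHS](big_mkord xpredT u).
rewrite (big_cat_nat (leq0n _) le_pn) /= [X in _ + X]big_nat_cond.
rewrite [X in _ + X]big1 ?addr0 //.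
by move=> b /andP[/andP[le_pb _] _]; rewrite /u nth_default ?mul0r.
Qed.

Lemma geom_sum_is_linear x : scalar (geom_sum x).
Proof.
move=> a p q; pose n := maxn (size (a *: p + q)) (maxn (size p) (size q)).
rewrite !(@geom_sum_widen _ _ n) ?leq_max ?leqnn ?orbT //.
rewrite mulr_sumr -big_split; apply: eq_bigr => b _ /=.
by rewrite coefD coefZ mulrDl mulrA.
Qed.

HB.instance Definition _ x :=
  GRing.isLinear.Build F {poly F} F _ (geom_sum x) (geom_sum_is_linear x).

Lemma geom_sumXn x n :
  geom_sum x 'X^n = (eulerian F n n).[x] / (1 - x) ^+ n.+1.
Proof.
rewrite (@geom_sum_widen _ _ n.+1) ?size_polyXn // big_ord_recr /= coefXn eqxx mul1r.
by rewrite big1 ?add0r // => b _; rewrite coefXn ltn_eqF ?mul0r.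
Qed.

(** Induction on m: 'X^k ('X + 1)^(m+1) = 'X^(k+1) ('X + 1)^m + 'X^k ('X + 1)^m
    matches [eulerian_step]. *)
Lemma geom_sum_eulerian x k m : x != 1 ->
  geom_sum x ('X^k * ('X + 1) ^+ m) =
  (eulerian F (k + m) k).[x] / (1 - x) ^+ (k + m).+1.
Proof.
move=> x1; elim: m k => [|m IHm] k; first by rewrite mulr1 addn0 geom_sumXn.
have -> : ('X^k * ('X + 1) ^+ m.+1 : {poly F}) =
          'X^(k.+1) * ('X + 1) ^+ m + 'X^k * ('X + 1) ^+ m.
  by rewrite !exprS; ring.
rewrite linearD /= !IHm addSnnS [in RHS]addnS eulerian_step ?leq_addr //.
rewrite !hornerE !addnS [(1 - x) ^+ (k + m).+2]exprS.
by field; rewrite expf_eq0 subr_eq0 eq_sym (negPf x1) andbF.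
Qed.

(** Splitting off the term n = 0 of the series; on monomials this is
    [eulerian_wrap]. *)
Lemma geom_sum_shift x p : x != 1 ->
  geom_sum x p = p.[0] + x * geom_sum x (p \Po ('X + 1)).
Proof.
move=> x1; have x1' : 1 - x != 0 by rewrite subr_eq0 eq_sym.
have shiftXn n : geom_sum x 'X^n = 0 ^+ n + x * geom_sum x (('X + 1) ^+ n).
  rewrite -[(_ + _) ^+ n]mul1r -(expr0 'X) geom_sum_eulerian // geom_sumXn add0n.
  case: n => [|n]; last by rewrite eulerian_wrap expr0n add0r hornerM hornerX mulrA.
  by rewrite !expr1 /= hornerC; field.
rewrite -{1 2 3}(coefK p) poly_def linear_sum horner_sum.
rewrite -[_ \Po _]/(comp_poly _ _) linear_sum linear_sum mulr_sumr -big_split.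
apply: eq_bigr => i _ /=; rewrite linearZ /= hornerZ hornerXn comp_polyZ linearZ /=.
by rewrite rmorphXn /= comp_polyX shiftXn; ring.
Qed.

(** Twice \sum_(m >= 1) p(2m-1) x^(2m): the odd part in x of x \sum_n p(n) x^n.
    The factor 2 avoids a division. *)
Definition odd_geom_sum x p : F := x * (geom_sum x p - geom_sum (- x) p).

Lemma odd_geom_sum_is_linear x : scalar (odd_geom_sum x).
Proof. by move=> a p q; rewrite /odd_geom_sum !linearP /=; ring. Qed.

HB.instance Definition _ x :=
  GRing.isLinear.Build F {poly F} F _ (odd_geom_sum x) (odd_geom_sum_is_linear x).

Lemma odd_geom_sum_comp x p : x != 1 -> x != -1 ->
  odd_geom_sum x (p \Po ('X + 1)) =
  geom_sum x p + geom_sum (- x) p - p.[0] *+ 2.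
Proof.
move=> x1 xN1; have xN1' : - x != 1 by rewrite eqr_oppLR.
by rewrite /odd_geom_sum ![geom_sum _ p]geom_sum_shift //; ring.
Qed.

Lemma odd_geom_sum_shift x p : x != 1 -> x != -1 ->
  odd_geom_sum x p = x ^+ 2 * (p.[1] *+ 2 + odd_geom_sum x (p \Po ('X + 2%:P))).
Proof.
move=> x1 xN1; have xN1' : - x != 1 by rewrite eqr_oppLR.
have two_steps y : y != 1 -> geom_sum y p =
    p.[0] + y * (p.[1] + y * geom_sum y (p \Po ('X + 2%:P))).
  move=> y1; rewrite geom_sum_shift // [geom_sum y (_ \Po _)]geom_sum_shift //.
  rewrite -comp_polyA comp_polyD comp_polyX -polyC1 comp_polyC -addrA -polyCD.
  by rewrite horner_comp !hornerE.
by rewrite /odd_geom_sum !two_steps //; ring.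
Qed.

End GeomSum.

(** * Chains of a finite poset *)

Section ChainSum.
Variables (T : finType) (le : rel T) (K : comNzRingType) (y : K).
Hypotheses (le_refl : reflexive le) (le_anti : antisymmetric le)
  (le_trans : transitive le).

Definition chain (C : {set T}) : bool :=
  [forall I in C, forall J in C, le I J || le J I].

Lemma chainP (C : {set T}) :
  reflect {in C &, forall I J, le I J || le J I} (chain C).
Proof.
apply: (iffP forall_inP) => [chC I J IC JC | chC I IC].
  by move/forall_inP: (chC I IC); apply.
by apply/forall_inP => J JC; apply: chC.
Qed.

Lemma chain_sub (C C' : {set T}) : C \subset C' -> chain C' -> chain C.
Proof.
move=> sCC /chainP chC'; apply/chainP => I J IC JC.
by apply: chC'; apply: (subsetP sCC).
Qed.

Definition is_top I (C : {set T}) := (I \in C) && [forall J in C, le J I].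

Lemma is_topP I (C : {set T}) :
  reflect (I \in C /\ {in C, forall J, le J I}) (is_top I C).
Proof. by apply: (iffP andP) => -[IC /forall_inP]. Qed.

(** An element of the chain with the most elements of the chain below it. *)
Lemma chain_has_top (C : {set T}) : C != set0 -> chain C ->
  exists I, is_top I C.
Proof.
case/set0Pn => I0 I0C /chainP chC.
case: (@arg_maxnP _ I0 [in C] (fun I => #|[set J in C | le J I]|) I0C) => I IC maxI.
exists I; apply/is_topP; split=> // J JC; have /orP[//|leIJ] := chC J I JC IC.
have sIJ : [set L in C | le L I] \subset [set L in C | le L J].
  by apply/subsetP => L; rewrite !inE => /andP[-> /le_trans->].
have /setP/(_ J) : [set L in C | le L I] = [set L in C | le L J].
  by apply/eqP; rewrite eqEcard sIJ; apply: maxI.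
by rewrite !inE JC le_refl.
Qed.

Lemma is_top_uniq (C : {set T}) I J : is_top I C -> is_top J C -> I = J.
Proof.
move=> /is_topP[IC topI] /is_topP[JC topJ].
by apply: le_anti; rewrite topI // topJ.
Qed.

Definition chain_sum (A : {set T}) : K :=
  \sum_(C : {set T} | (C \subset A) && chain C) y ^+ #|C|.

Definition below (A : {set T}) I := [set J in A | le J I && (J != I)].

Lemma in_below (A : {set T}) I J : (J \in below A I) = [&& J \in A, le J I & J != I].
Proof. by rewrite inE. Qed.

(** The recursion of [chain_sum_rec] stays within one family of sets. *)
Lemma below_below (A : {set T}) I J : J \in below A I ->
  below (below A I) J = below A J.
Proof.
rewrite in_below => /and3P[_ leJI nJI]; apply/setP => L; rewrite !in_below.
have [LA|//] := boolP (L \in A); have [leLJ|] := boolP (le L J); last by rewrite andbF.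
rewrite (le_trans leLJ leJI) /= andb_idl // => _.
by apply: contra nJI => /eqP eLI; apply/eqP/le_anti; rewrite leJI -eLI.
Qed.

(** Chains of A with largest element I correspond to chains strictly below I; the
    last conjunct on the left is the side condition of the reindexing. *)
Lemma is_top_chain_setU1 (A C : {set T}) I : I \in A ->
  [&& I |: C \subset A, chain (I |: C), is_top I (I |: C) & (I |: C) :\ I == C] =
  (C \subset below A I) && chain C.
Proof.
move=> IA; apply/and4P/andP => [[sCA chC /is_topP[_ topI] /eqP eqC] | [sCA chC]].
  split; last by apply: chain_sub chC; rewrite subsetUr.
  apply/subsetP => J JC; rewrite inE (subsetP sCA) ?topI ?setU1r //=.
  by move: JC; rewrite -{1}eqC !inE => /andP[].
have CP J : J \in C -> [/\ J \in A, le J I & J != I].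
  by move/(subsetP sCA); rewrite inE => /and3P.
have topI J : J \in I |: C -> le J I by case/setU1P => [->|/CP[]].
split.
- by apply/subsetP => J /setU1P[->|/CP[]].
- apply/chainP => J L JC LC; case/setU1P: (JC) => [->|JC']; first by rewrite topI ?orbT.
  by case/setU1P: (LC) => [->|LC']; [rewrite topI | apply: (chainP _ chC)].
- by apply/is_topP; rewrite setU11.
by rewrite setU1K //; apply: contraT => /negPn/CP[_ _ /eqP].
Qed.

(** Sorting the non-empty chains by their largest element. *)
Lemma chain_sum_rec (A : {set T}) :
  chain_sum A = 1 + \sum_(I in A) y * chain_sum (below A I).
Proof.
rewrite /chain_sum (bigD1 set0) /=; last first.
  by rewrite sub0set; apply/chainP => I J; rewrite inE.
rewrite cards0 expr0; congr (_ + _).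
transitivity (\sum_(C : {set T} | (C \subset A) && chain C && (C != set0))
                \sum_(I in A | is_top I C) y ^+ #|C|).
  apply: eq_bigr => C /andP[/andP[sCA chC] /chain_has_top/(_ chC)[I topI]].
  rewrite (big_pred1 I) // => J; apply/andP/eqP => [[_ topJ]|->].
    exact: is_top_uniq topJ topI.
  by split=> //; apply: (subsetP sCA); case/is_topP: topI.
rewrite (exchange_big_dep [in A]) /=; last by move=> ? ? _ /andP[].
apply: eq_bigr => I IA; rewrite mulr_sumr.
rewrite (reindex_onto (fun C => I |: C) (fun C => C :\ I)) /=; last first.
  by move=> C /and3P[_ _ /is_topP[IC _]]; rewrite setD1K.
apply: eq_big => [C | C /andP[_ /eqP eqC]]; last first.
  have IC : I \notin C by rewrite -eqC setD11.
  by rewrite cardsU1 IC exprS.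
rewrite -is_top_chain_setU1 // IA /= -!andbA.
rewrite -[I |: C != set0]negbK; case: (_ =P set0) => //= e0.
by move: (setU11 I C); rewrite e0 inE.
Qed.

End ChainSum.

(** * Chains of intervals *)

Section SubsetSums.
Variables (V : finType) (K : comNzRingType) (q : K).
Implicit Types A B U S : {set V}.

Lemma sum_subset_exp U : \sum_(S : {set V} | S \subset U) q ^+ #|S| = (q + 1) ^+ #|U|.
Proof.
rewrite exprD1n (partition_big (fun S => inord #|S| : 'I_#|U|.+1) xpredT) //=.
apply: eq_bigr => k _; rewrite -cards_draws -sumr_const; apply: eq_big => [S|S].
  rewrite inE; case: (boolP (S \subset U)) => //= sSU.
  by rewrite -val_eqE /= inordK // ltnS subset_leq_card.
by case/andP=> sSU /eqP <-; rewrite inordK // ltnS subset_leq_card.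
Qed.

Lemma sum_interval_exp_top A B : A \subset B ->
  \sum_(S : {set V} | (A \subset S) && (S \subset B)) q ^+ #|S :\: A| =
  (q + 1) ^+ #|B :\: A|.
Proof.
move=> sAB; rewrite -sum_subset_exp.
rewrite (reindex_onto (fun S => A :|: S) (fun S => S :\: A)) /=; last first.
  by move=> S /andP[sAS _]; rewrite -[RHS](setID S A) (setIidPr sAS).
apply: eq_big => [S | S /andP[_ /eqP->] //].
rewrite subsetUl subUset sAB /= subsetD setDUl setDv set0U.
by congr (_ && _); apply/eqP/setDidPl.
Qed.

Lemma sum_interval_exp_bottom A B : A \subset B ->
  \sum_(S : {set V} | (A \subset S) && (S \subset B)) q ^+ #|B :\: S| =
  (q + 1) ^+ #|B :\: A|.
Proof.
move=> sAB; rewrite -sum_subset_exp.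
rewrite (reindex_onto (fun S => B :\: S) (fun S => B :\: S)) /=; last first.
  by move=> S /andP[_ sSB]; rewrite setDDr setDv set0U; apply/setIidPr.
apply: eq_big => [S | S /andP[_ /eqP->] //].
rewrite subsetDl andbT setDDr setDv set0U [S \subset _]subsetD.
apply/andP/andP => [[sABS /eqP/setIidPr sSB] | [sSB dSA]].
  by split=> //; move: sABS; rewrite subsetD disjoint_sym => /andP[].
by rewrite subsetD sAB disjoint_sym; split=> //; apply/eqP/setIidPr.
Qed.
End SubsetSums.

Section Intervals.
Variables (V : finType) (D : {set {set V}}).
Hypothesis D_complex : simplicial_complex D.
Implicit Types I J : {set V} * {set V}.

Lemma interval_le_refl : reflexive (@interval_le V).
Proof. by move=> I; rewrite /interval_le !subxx. Qed.

Lemma interval_le_anti : antisymmetric (@interval_le V).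
Proof.
move=> [A B] [A' B'] /andP[/andP[/= s1 s2] /andP[/= s3 s4]].
by congr (_, _); apply/eqP; rewrite eqEsubset ?s1 ?s2 ?s3 ?s4.
Qed.

Lemma interval_le_trans : transitive (@interval_le V).
Proof.
move=> J I L /andP[s1 s2] /andP[s3 s4].
by rewrite /interval_le (subset_trans s3) ?(subset_trans s2).
Qed.

Lemma intervals_down I J :
  I \in intervals D -> J.1 \subset J.2 -> interval_le J I -> J \in intervals D.
Proof.
rewrite !inE => /and3P[I0 sI ID] sJ /andP[s1 s2]; rewrite sJ.
rewrite (D_complex.2 _ _ s2 ID) !andbT.
by apply: contra I0 => /eqP J0; rewrite -subset0 -J0.
Qed.

Definition ilen I := #|I.2 :\: I.1|.

(** A subinterval [A', B'] of [A, B] is a choice of B' between A and B, then of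
    A' between A and B': the two binomial expansions compose. *)
Lemma sum_subintervals (K : comNzRingType) (q : K) I : I \in intervals D ->
  \sum_(J in intervals D | interval_le J I) q ^+ ilen J = (q + 1 + 1) ^+ ilen I.
Proof.
move=> ID; have := ID; rewrite inE => /and3P[_ sI _].
rewrite /ilen -(sum_interval_exp_top _ sI).
transitivity (\sum_(B : {set V} | (I.1 \subset B) && (B \subset I.2))
   \sum_(A : {set V} | (I.1 \subset A) && (A \subset B)) q ^+ #|B :\: A|); last first.
  by apply: eq_bigr => B /andP[sIB _]; rewrite sum_interval_exp_bottom.
rewrite pair_big_dep /= (reindex (fun J => (J.2, J.1))) /=; last first.
  by exists (fun J => (J.2, J.1)) => -[].
apply: eq_bigl => -[B A] /=; rewrite /interval_le /=.
apply/andP/andP => [[JD /andP[s1 s2]] | [/andP[s1 s2] /andP[s3 s4]]].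
  move: JD; rewrite inE /= => /and3P[_ sAB _].
  by rewrite s1 s2 sAB (subset_trans s1).
by rewrite s3 s2; split=> //; apply: intervals_down ID _ _ => //; apply/andP.
Qed.

(** Over a fixed upper end B, the lower ends are all the subsets of B except the
    empty one. *)
Lemma sum_intervals (K : comNzRingType) (q : K) :
  \sum_(I in intervals D) q ^+ ilen I =
  \sum_(B in D) ((q + 1) ^+ #|B| - q ^+ #|B|).
Proof.
transitivity (\sum_(B in D) \sum_(A : {set V} | (A \subset B) && (A != set0))
   q ^+ #|B :\: A|); last first.
  apply: eq_bigr => B _.
  have := sum_interval_exp_bottom q (sub0set B); rewrite setD0 => <-.
  rewrite [in RHS](bigD1 set0) ?sub0set //= setD0 addrC addrK.
  by apply: eq_bigl => A; rewrite sub0set.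
rewrite pair_big_dep /= (reindex (fun J => (J.2, J.1))) /=; last first.
  by exists (fun J => (J.2, J.1)) => -[].
by apply: eq_bigl => -[B A]; rewrite inE /= andbA andbC [(A != _) && _]andbC.
Qed.

(** Strict inclusion of intervals is detected by the number of elements of
    I.2 :\: I.1, which serves as the induction measure and bounds the length of
    chains. *)
Lemma ilen_ltn I J : I.1 \subset I.2 -> J.1 \subset J.2 ->
  interval_le J I -> J != I -> (ilen J < ilen I)%N.
Proof.
move=> sI sJ /andP[s1 s2] nJI; rewrite proper_card // properEneq setDSS // andbT.
apply: contra nJI => /eqP eIJ; case: I J => [A B] [A' B'] /= in sI sJ s1 s2 eIJ *.
have eA : A' = A.
  apply/eqP; rewrite eqEsubset s1 andbT; apply/subsetP => v vA'.
  have: v \notin B :\: A by rewrite -eIJ inE vA'.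
  by rewrite inE (subsetP s2) ?(subsetP sJ) // andbT negbK.
rewrite eA in eIJ *; apply/eqP; congr (_, _).
by rewrite -(setID B' A) -(setID B A) eIJ (setIidPr sI) (setIidPr (subset_trans s1 sJ)).
Qed.

Section Generating.
Variables (F : fieldType) (x y : F).
Hypotheses (x1 : x != 1) (xN1 : x != -1) (xy : y * (1 - x ^+ 2) = x ^+ 2).

Notation chains := (chain_sum (@interval_le V) y).
Notation belowD := (below (@interval_le V) (intervals D)).

(** Multiplication by y = x^2 / (1 - x^2) inserts the interval I on top of the
    chains below it, so the left side is twice the generating function of the
    chains with top I.  It depends only on the length b of I, because both sides
    solve the recursion obtained by removing the top: there the sum over the
    subintervals turns 'X^b into ('X + 2)^b, which is the shift by two of
    [odd_geom_sum_shift]. *)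
Lemma chain_sum_below_interval I : I \in intervals D ->
  (y * chains (belowD I)) *+ 2 = odd_geom_sum x 'X^(ilen I).
Proof.
have [n] := ubnP (ilen I); elim: n I => // n IHn I; rewrite ltnS => leIn ID.
rewrite (chain_sum_rec _ interval_le_refl interval_le_anti interval_le_trans).
rewrite mulrDr mulr1 mulrnDl -mulrnAr -sumrMnl.
have IH J : J \in belowD I ->
    (y * chains (below (@interval_le V) (belowD I) J)) *+ 2 = odd_geom_sum x 'X^(ilen J).
  move=> JI; rewrite (below_below interval_le_anti interval_le_trans JI).
  move: JI; rewrite in_below => /and3P[JD leJI nJI]; apply: IHn => //.
  apply: leq_trans leIn; move: JD ID; rewrite !inE.
  by case/and3P=> _ sJ _ /and3P[_ sI _]; apply: ilen_ltn.
rewrite (eq_bigr _ IH).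
rewrite -linear_sum /=.
have -> : \sum_(J in belowD I) 'X^(ilen J) =
    ('X + 2%:P) ^+ ilen I - 'X^(ilen I) :> {poly F}.
  have -> : 'X + 2%:P = 'X + 1 + 1 :> {poly F} by rewrite -addrA -polyC1 -polyCD.
  rewrite -(sum_subintervals _ ID) [in RHS](bigD1 I) /=; last first.
    by rewrite ID interval_le_refl.
  by rewrite addrAC subrr add0r; apply: eq_bigl => J; rewrite in_below andbA.
rewrite linearB /= [odd_geom_sum x 'X^_]odd_geom_sum_shift //.
rewrite comp_Xn_poly hornerXn expr1n.
set o := odd_geom_sum x _; have t1 : 1 - x ^+ 2 != 0.
  by rewrite subr_eq0 eq_sym sqrf_eq1 negb_or x1.
rewrite (canRL (mulfK t1) xy).
by field.
Qed.

(** Summing over all intervals turns 'X^#|B| into ('X + 1)^#|B| - 'X^#|B|, and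
    [odd_geom_sum_comp] exchanges the shift by one for the even part of the
    series. *)
Lemma chain_sum_intervals :
  chains (intervals D) *+ 2 =
  (1 - x) * geom_sum x (\sum_(B in D) 'X^#|B|) +
  (1 + x) * geom_sum (- x) (\sum_(B in D) 'X^#|B|).
Proof.
rewrite (chain_sum_rec _ interval_le_refl interval_le_anti interval_le_trans).
rewrite mulrnDl -sumrMnl; under eq_bigr => I ID do rewrite chain_sum_below_interval //.
rewrite -linear_sum sum_intervals /= sumrB linearB /=.
set p := \sum_(B in D) 'X^#|B|.
have -> : \sum_(B in D) ('X + 1) ^+ #|B| = p \Po ('X + 1) :> {poly F}.
  rewrite -[_ \Po _]/(comp_poly _ _) linear_sum; apply: eq_bigr => B _ /=.
  by rewrite comp_Xn_poly.
have p0 : p.[0] = 1.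
  rewrite horner_sum (bigD1 set0) /= ?D_complex.1 // cards0 hornerXn expr0 big1 ?addr0 //.
  by move=> B /andP[_ B0]; rewrite hornerXn expr0n cards_eq0 (negPf B0).
by rewrite odd_geom_sum_comp // p0 /odd_geom_sum; ring.
Qed.
End Generating.
End Intervals.

(** * h-vectors and the rank of the interval subdivision *)

Section HVector.
Variables (V : finType) (D : {set {set V}}).

Lemma card_le_rank (F : {set V}) : F \in D -> (#|F| <= rank D)%N.
Proof. exact: (@leq_bigmax_cond _ [in D] (fun F : {set V} => #|F|)). Qed.

Lemma sum_by_card (K : nzRingType) (u : nat -> K) :
  \sum_(F in D) u #|F| = \sum_(i < (rank D).+1) (fvec D (i%:Z - 1))%:R * u i.
Proof.
rewrite (partition_big (fun F : {set V} => inord #|F| : 'I_(rank D).+1) xpredT) //=.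
apply: eq_bigr => i _; rewrite mulr_natl -sumr_const.
apply: eq_big => [F | F /andP[FD /eqP <-]]; last by rewrite inordK // ltnS card_le_rank.
rewrite inE; case: (boolP (F \in D)) => //= FD.
by rewrite /face_dim (inj_eq (addIr _)) eqz_nat -val_eqE /= inordK // ltnS card_le_rank.
Qed.

(** The homogeneous form of the relation between h- and f-vectors; the choices
    (a, b) = (t, 1) and (a, b) = ('X, 'X + 1) give the h-polynomial and the
    expansion of the f-polynomial in the basis 'X^j ('X + 1)^(d-j). *)
Lemma hvec_homogenize (K : comNzRingType) (a b : K) :
  \sum_(k < (rank D).+1) (hvec D k)%:~R * (a ^+ k * b ^+ (rank D - k)) =
  \sum_(F in D) a ^+ #|F| * (b - a) ^+ (rank D - #|F|).
Proof.
set d := rank D.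
rewrite (sum_by_card (fun i => a ^+ i * (b - a) ^+ (d - i))) -/d.
pose f (i : nat) : K := (fvec D (i%:Z - 1))%:R.
pose g i k : K := (-1) ^+ (k - i) * 'C(d - i, k - i)%:R * f i * (a ^+ k * b ^+ (d - k)).
transitivity (\sum_(k < d.+1) \sum_(i < d.+1 | (i < k.+1)%N) g i k).
  apply: eq_bigr => k _.
  rewrite -(@big_ord_widen_cond _ _ _ _ _ xpredT (g^~ k)) //.
  rewrite /hvec rmorph_sum /= mulr_suml.
  by apply: eq_bigr => i _; rewrite !rmorphM rmorphXn rmorphN1.
rewrite (exchange_big_dep xpredT) //=; apply: eq_bigr => i _.
transitivity (\sum_(i <= k < d.+1) g i k).
  by rewrite (big_nat_widenl i 0) // big_mkord.
have le_id : (i <= d)%N by rewrite -ltnS.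
rewrite -{1}[val i]add0n big_addn subSn // big_mkord addrC exprDn !mulr_sumr.
apply: eq_bigr => l _; rewrite /g addnK addnC subnDA -/(f i) [(- a) ^+ _]exprNn exprD.
rewrite -[X in _ = _ * (_ * X)]mulr_natr /=.
move: ((-1) ^+ l) (a ^+ i) (a ^+ l) (b ^+ _) (f i) (_%:R) => e u v w fi c.
by ring.
Qed.
Lemma hvec0 : simplicial_complex D -> hvec D 0 = 1.
Proof.
move=> D_complex; rewrite /hvec big_ord_recl big_ord0 addr0 /= bin0 expr0 !mul1r sub0r.
rewrite /fvec (_ : [set F in D | _] = [set set0]) ?cards1 //.
apply/setP => F; rewrite !inE /face_dim -subr_eq0 opprK subrK.
rewrite -[0]/(Posz 0) eqz_nat cards_eq0.
by case: eqP => [->|]; rewrite ?andbF // D_complex.1.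
Qed.

End HVector.

Section RankInt.
Variables (V : finType) (D : {set {set V}}).
Hypothesis D_complex : simplicial_complex D.

Lemma ilen_lt_rank I : I \in intervals D -> (ilen I < rank D)%N.
Proof.
rewrite inE => /and3P[I0 sI ID]; apply: leq_trans (card_le_rank ID).
apply: proper_card; rewrite properEneq subsetDl andbT.
apply: contra I0 => /eqP eI; rewrite -subset0; apply/subsetP => v vI.
by move: (subsetP sI v vI); rewrite -eI inE vI.
Qed.

(** The length I.2 :\: I.1 is injective on a chain. *)
Lemma card_chain_intervals C : C \in interval_subdivision D -> (#|C| <= rank D)%N.
Proof.
rewrite inE => /andP[sCD /(chainP _ C) chC].
have [C0|/set0Pn[I0 I0C]] := eqVneq C set0; first by rewrite C0 cards0.
have r0 : (0 < rank D)%N by apply: leq_trans (ilen_lt_rank (subsetP sCD _ I0C)).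
have inj : {in C &, injective (fun I => insubd (Ordinal r0) (ilen I))}.
  move=> I J IC JC /(congr1 val); rewrite !val_insubd !ilen_lt_rank ?(subsetP sCD) //.
  move=> eIJ; apply/eqP; apply: contraT => nIJ.
  have [sI sJ] : I.1 \subset I.2 /\ J.1 \subset J.2.
    move: (subsetP sCD _ IC) (subsetP sCD _ JC).
    by rewrite !inE => /and3P[_ -> _] /and3P[_ -> _].
  by have /orP[le|le] := chC I J IC JC; have := ilen_ltn _ _ le;
    rewrite eIJ ltnn => -> //; rewrite eq_sym.
by rewrite -(card_in_imset inj) (leq_trans (max_card _)) // card_ord.
Qed.

(** Upper bound: the lengths in a chain of intervals are distinct and less than
    the rank.  Lower bound: for a largest face F with elements v_1, v_2, ..., the
    intervals from {v_1} to {v_1, ..., v_i} form a chain of #|F| elements. *)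
Lemma rank_interval_subdivision : rank (interval_subdivision D) = rank D.
Proof.
apply/eqP; rewrite eqn_leq; apply/andP; split.
  by apply/bigmax_leqP => C; apply: card_chain_intervals.
have [F FD ->] : exists2 F, F \in D & rank D = #|F|.
  rewrite /rank; have D0 : (0 < #|D|)%N by apply/card_gt0P; exists set0; case: D_complex.
  by have [F FD eF] := eq_bigmax_cond (fun F : {set V} => #|F|) D0; exists F.
pose B i := [set x in take i (enum F)].
have cB i : (i <= #|F|)%N -> #|B i| = i.
  move=> le_iF; rewrite cardsE (card_uniqP _) ?take_uniq ?enum_uniq //.
  rewrite size_take_min -cardE.
  exact/minn_idPl.
have sB i j : (i <= j)%N -> B i \subset B j.
  move=> le_ij; apply/subsetP => v; rewrite !inE -(take_takel _ le_ij); exact: mem_take.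
have sBF i : B i \subset F.
  by apply/subsetP => v; rewrite inE => /mem_take; rewrite mem_enum.
pose C := [set (B 1%N, B (i : 'I_#|F|).+1) | i in 'I_#|F|].
have <- : #|C| = #|F|.
  rewrite card_imset ?card_ord // => i j [/(congr1 (fun A : {set V} => #|A|))].
  by rewrite !cB // => -[/val_inj].
apply: card_le_rank; rewrite inE; apply/andP; split.
  apply/subsetP => _ /imsetP[i _ ->]; rewrite inE /= sB //.
  by rewrite -card_gt0 cB ?(leq_trans _ (ltn_ord i)) // (D_complex.2 _ _ (sBF _) FD).
apply/chainP => _ _ /imsetP[i _ ->] /imsetP[j _ ->]; rewrite /interval_le /= subxx /=.
by have [le|/ltnW le] := leqP i j; apply/orP; [left|right]; apply: sB.
Qed.

Lemma chain_sum_interval_subdivision (K : comNzRingType) (y : K) :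
  chain_sum (@interval_le V) y (intervals D) =
  \sum_(C in interval_subdivision D) y ^+ #|C|.
Proof. by apply: eq_bigl => C; rewrite inE. Qed.

End RankInt.

(** * The h-polynomial as an even part *)

Section EvenPart.
Variables (V : finType) (D : {set {set V}}).
Hypothesis D_complex : simplicial_complex D.
Notation d := (rank D).

(** The h-polynomial of the barycentric subdivision of D. *)
Definition hpoly_sd (K : comNzRingType) : {poly K} :=
  \sum_(j < d.+1) (hvec D j)%:~R *: eulerian K d j.

(** The polynomial [hpoly] of the interval subdivision over any coefficient ring,
    written with the rank of D (see [rank_interval_subdivision]). *)
Definition hpoly_interval (K : comNzRingType) : {poly K} :=
  \sum_(k < d.+1) (hvec (interval_subdivision D) k)%:~R *: 'X^k.

Lemma horner_hpoly_interval (K : comNzRingType) (t : K) :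
  (hpoly_interval K).[t] =
  \sum_(C in interval_subdivision D) t ^+ #|C| * (1 - t) ^+ (d - #|C|).
Proof.
have := hvec_homogenize (interval_subdivision D) t 1.
rewrite rank_interval_subdivision // => <-.
rewrite horner_sum; apply: eq_bigr => k _.
by rewrite hornerZ hornerXn expr1n mulr1.
Qed.

(** The f-polynomial of D is \sum_k h_k 'X^k ('X + 1)^(d-k), and each summand is
    evaluated by [geom_sum_eulerian]. *)
Lemma geom_sum_hpoly_sd (F : fieldType) (x : F) : x != 1 ->
  geom_sum x (\sum_(B in D) 'X^#|B|) = (hpoly_sd F).[x] / (1 - x) ^+ d.+1.
Proof.
move=> x1.
have -> : \sum_(B in D) 'X^#|B| =
    \sum_(k < d.+1) (hvec D k)%:~R * ('X^k * ('X + 1) ^+ (d - k)) :> {poly F}.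
  rewrite hvec_homogenize; apply: eq_bigr => B _.
  by rewrite addrAC subrr add0r expr1n mulr1.
rewrite linear_sum horner_sum mulr_suml; apply: eq_bigr => k _.
have le_kd : (k <= d)%N by rewrite -ltnS.
rewrite mulrzl raddfMz /= geom_sum_eulerian // subnKC //.
by rewrite hornerZ -mulrzl mulrA.
Qed.

Lemma hpoly_interval_even_part (F : fieldType) (x : F) : x != 1 -> x != -1 ->
  (hpoly_interval F).[x ^+ 2] *+ 2 =
  (1 + x) ^+ d * (hpoly_sd F).[x] + (1 - x) ^+ d * (hpoly_sd F).[- x].
Proof.
move=> x1 xN1; have t1 : 1 - x ^+ 2 != 0.
  by rewrite subr_eq0 eq_sym sqrf_eq1 negb_or x1.
have [a0 b0] : 1 - x != 0 /\ 1 + x != 0.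
  by rewrite subr_eq0 eq_sym x1 addrC addr_eq0.
pose y := x ^+ 2 / (1 - x ^+ 2).
have -> : (hpoly_interval F).[x ^+ 2] =
    (1 - x ^+ 2) ^+ d * chain_sum (@interval_le V) y (intervals D).
  rewrite horner_hpoly_interval chain_sum_interval_subdivision mulr_sumr.
  apply: eq_bigr => C CI; rewrite expr_div_n expfB_cond ?(negPf t1); last first.
    exact: card_chain_intervals.
  by rewrite mulrCA.
rewrite -mulrnAr (@chain_sum_intervals _ _ D_complex _ _ _ x1 xN1) ?divfK //.
rewrite !geom_sum_hpoly_sd ?eqr_oppLR // opprK ![_ ^+ (rank D).+1]exprS.
have -> : 1 - x ^+ 2 = (1 - x) * (1 + x) by ring.
rewrite exprMn; have := (expf_neq0 d a0, expf_neq0 d b0).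
move: ((1 - x) ^+ d) ((1 + x) ^+ d) => u v [u0 v0].
by field; rewrite a0 b0 u0 v0.
Qed.
End EvenPart.

(** * Even parts of polynomials with negative roots *)

Section Stability.
Variable C : numClosedFieldType.

(** For r <= 0 and Re z >= 0 the point z is at least as far from r as -z is; the
    product over the roots gives the claim.  The condition on Re z is written
    with z + z^* throughout. *)
Lemma horner_nonpos_roots_reflect (p : {poly C}) (z : C) :
  (forall r, root p r -> r <= 0) -> 0 <= z + z^* -> `|p.[- z]| <= `|p.[z]|.
Proof.
move=> p_roots z_ge0; have [s Dp] := closed_field_poly_normal p.
have [->|p0] := eqVneq p 0; first by rewrite !horner0.
have s_roots r : r \in s -> r <= 0.
  move=> rs; apply: p_roots; rewrite Dp rootZ ?lead_coef_eq0 //.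
  by rewrite root_prod_XsubC.
rewrite Dp !hornerZ !normrM ler_wpM2l //.
elim: s s_roots {Dp} => [|r s IHs] s_roots; first by rewrite big_nil !hornerC.
rewrite big_cons !hornerM !normrM ler_pM //; last first.
  by apply: IHs => q qs; apply: s_roots; rewrite inE qs orbT.
have r_le0 : r <= 0 by apply: s_roots; rewrite inE eqxx.
rewrite !hornerXsubC -(@ler_pXn2r _ 2) ?nnegrE // !normCK !rmorphB /= !rmorphN /=.
rewrite (CrealP (ler0_real r_le0)) -subr_ge0.
have -> : (z - r) * (z^* - r) - (- z - r) * (- z^* - r) = (- r *+ 2) * (z + z^*) by ring.
by rewrite mulr_ge0 // mulrn_wge0 // oppr_ge0.
Qed.

(** The easy half of the Hermite-Biehler theorem: the factor (1 + z)^n is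
    strictly larger in modulus than (1 - z)^n, hence no cancellation. *)
Lemma even_part_neq0 n (p : {poly C}) (z : C) : (0 < n)%N ->
    (forall r, root p r -> r < 0) -> 0 < z + z^* ->
  (1 + z) ^+ n * p.[z] + (1 - z) ^+ n * p.[- z] != 0.
Proof.
move=> n_gt0 p_roots z_gt0; rewrite addr_eq0; apply/eqP => /(congr1 Num.norm).
have pz : 0 < `|p.[z]|.
  rewrite normr_gt0; apply: contraTN z_gt0 => /p_roots z_lt0.
  by rewrite (CrealP (ltr0_real z_lt0)) -mulr2n pmulrn_lgt0 // lt_gtF.
have le_p : `|p.[- z]| <= `|p.[z]|.
  by apply: horner_nonpos_roots_reflect (ltW z_gt0) => r /p_roots/ltW.
have lt_z : `|1 - z| < `|1 + z|.
  rewrite -(@ltr_pXn2r _ 2) ?nnegrE // !normCK rmorphB rmorphD /= rmorph1 -subr_gt0.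
  have -> : (1 + z) * (1 + z^*) - (1 - z) * (1 - z^*) = (z + z^*) *+ 2 by ring.
  by rewrite pmulrn_lgt0.
rewrite normrN !normrM !normrX => e; have := ltxx (`|1 + z| ^+ n * `|p.[z]|).
rewrite {1}e (le_lt_trans (ler_wpM2l _ le_p)) ?exprn_ge0 //.
by rewrite ltr_pM2r // ltrXn2r // -lt0n.
Qed.
End Stability.

(** * Roots of the h-polynomial *)

Section Roots.
Variables (V : finType) (D : {set {set V}}) (C : numClosedFieldType).
Hypotheses (D_complex : simplicial_complex D)
  (h_ge0 : forall i : nat, (i <= rank D)%N -> 0 <= hvec D i).

Lemma hpoly_sd_roots (r : C) : root (hpoly_sd D C) r -> r < 0.
Proof.
apply: (@eulerian_comb_roots _ _ (fun j => (hvec D j)%:~R)) => [j le_jd|].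
  by rewrite ler0z h_ge0.
by rewrite ltr0z hvec0.
Qed.

(** The value at 1 counts the faces of maximal size.  The point t = 1 is out of
    reach of [hpoly_interval_even_part], where t = x^2 with x != 1, -1. *)
Lemma hpoly_interval_1_neq0 : (hpoly_interval D C).[1] != 0.
Proof.
rewrite horner_hpoly_interval //.
have I0 : (0 < #|interval_subdivision D|)%N.
  by apply/card_gt0P; exists set0; case: (interval_subdivision_complex D).
have [E EI rE] := eq_bigmax_cond (fun E : {set {set V} * {set V}} => #|E|) I0.
have {}rE : rank D = #|E| by rewrite -rE -(rank_interval_subdivision D_complex).
rewrite (bigD1 E) //= rE subnn expr0 expr1n mulr1 gt_eqF // ltr_wpDr // sumr_ge0 //.
by move=> B _; rewrite expr1n mul1r subrr exprn_ge0.
Qed.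

(** If z^2 = t, then neither z nor -z has positive real part, so z^* = -z and
    t = - `|z|^2. *)
Lemma hpoly_interval_roots (t : C) : root (hpoly_interval D C) t -> t <= 0.
Proof.
move=> rt; have [t1|t1] := eqVneq t 1.
  by move: rt; rewrite t1 rootE (negPf hpoly_interval_1_neq0).
(* Which square root is taken is immaterial: both signs are excluded. *)
pose z := sqrtC t; have zt : z ^+ 2 = t by rewrite sqrtCK.
have [r0|r_gt0] := posnP (rank D).
  move: rt; rewrite rootE /hpoly_interval r0 big_ord_recl big_ord0 addr0 hornerZ hornerXn.
  by rewrite mulr1 hvec0 ?oner_eq0 //; apply: interval_subdivision_complex.
have no_root w : w ^+ 2 = t -> ~~ (0 < w + w^*).
  move=> wt; apply/negP => w_gt0; move: t1; rewrite -wt sqrf_eq1 negb_or => /andP[w1 wN1].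
  have := even_part_neq0 r_gt0 hpoly_sd_roots w_gt0.
  by rewrite -hpoly_interval_even_part // wt (eqP rt) mul0rn eqxx.
have zR : z + z^* \is Num.real by apply/CrealP; rewrite rmorphD /= conjCK addrC.
have /eqP : z + z^* = 0.
  apply/eqP; rewrite eq_le !real_leNgt ?real0 // no_root //.
  by have := no_root (- z); rewrite sqrrN rmorphN -opprD oppr_gt0 => ->.
rewrite addr_eq0 => /eqP ez.
by rewrite -zt expr2 {1}ez mulNr oppr_le0 mulrC -normCK exprn_ge0.
Qed.
End Roots.

(** * Log-concavity and unimodality from non-positive roots *)

Section LogConcave.
Variable K : numFieldType.

(** Total positivity of order two of the Toeplitz matrix of a, for adjacent
    shifts: it is stronger than log-concavity, which is the case i = j, and
    for non-negative a, unlike log-concavity, it rules out internal zeros. *)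
Definition tp2 (a : nat -> K) :=
  forall i j, (i <= j)%N -> a i * a j.+2 <= a i.+1 * a j.+1.

(** With s = - r >= 0 the new coefficients are a_(i-1) + s a_i.  The difference
    of the two products is a polynomial in s whose coefficients are
    non-negative by the inequalities for a; the coefficient of s telescopes over
    two of them. *)
Lemma tp2_mulXsubC (p : {poly K}) (r : K) : r <= 0 ->
    (forall i, 0 <= p`_i) -> tp2 (nth 0 p) ->
  (forall i, 0 <= (('X - r%:P) * p)`_i) /\ tp2 (nth 0 (('X - r%:P) * p)).
Proof.
move=> r_le0 p_ge0 p_tp2; have s_ge0 : 0 <= - r by rewrite oppr_ge0.
have c0 : (('X - r%:P) * p)`_0 = - r * p`_0.
  by rewrite mulrBl coefB coefXM coefCM sub0r mulNr.
have cS i : (('X - r%:P) * p)`_i.+1 = p`_i + - r * p`_i.+1.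
  by rewrite mulrBl coefB coefXM coefCM mulNr.
split=> [[|i]|i j]; [by rewrite c0 mulr_ge0 | by rewrite cS addr_ge0 ?mulr_ge0 |].
move: (- r) s_ge0 c0 cS => s s_ge0 c0 cS.
have tp i' j' (le : (i' <= j')%N) : 0 <= p`_i'.+1 * p`_j'.+1 - p`_i' * p`_j'.+2.
  by rewrite subr_ge0 p_tp2.
case: i => [|i]; case: j => [|j] //= le_ij; rewrite ?c0 !cS -subr_ge0.
- have -> : (p`_0 + s * p`_1) * (p`_0 + s * p`_1) - s * p`_0 * (p`_1 + s * p`_2) =
    p`_0 * p`_0 + s * (p`_1 * p`_0) + s ^+ 2 * (p`_1 * p`_1 - p`_0 * p`_2) by ring.
  by rewrite !addr_ge0 ?mulr_ge0 ?exprn_ge0 ?tp.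
- have -> : (p`_0 + s * p`_1) * (p`_j.+1 + s * p`_j.+2) -
    s * p`_0 * (p`_j.+2 + s * p`_j.+3) =
    p`_0 * p`_j.+1 + s * (p`_1 * p`_j.+1) +
    s ^+ 2 * (p`_1 * p`_j.+2 - p`_0 * p`_j.+3) by ring.
  by rewrite !addr_ge0 ?mulr_ge0 ?exprn_ge0 ?tp.
have le_ij' : (i <= j)%N by [].
(* For i < j this is a_i a_(j+3) <= a_(i+1) a_(j+2) <= a_(i+2) a_(j+1); for
   i = j the first inequality is already the claim. *)
have mid : 0 <= p`_i.+2 * p`_j.+1 - p`_i * p`_j.+3.
  have step : p`_i * p`_j.+3 <= p`_i.+1 * p`_j.+2 by rewrite p_tp2 // leqW.
  rewrite subr_ge0; move: le_ij' step; rewrite leq_eqVlt => /predU1P[<-|lt_ij] step.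
    by rewrite [leRHS]mulrC.
  exact: le_trans step (p_tp2 i.+1 j lt_ij).
have -> : (p`_i.+1 + s * p`_i.+2) * (p`_j.+1 + s * p`_j.+2) -
    (p`_i + s * p`_i.+1) * (p`_j.+2 + s * p`_j.+3) =
    (p`_i.+1 * p`_j.+1 - p`_i * p`_j.+2) +
    s ^+ 2 * (p`_i.+2 * p`_j.+2 - p`_i.+1 * p`_j.+3) +
    s * (p`_i.+2 * p`_j.+1 - p`_i * p`_j.+3) by ring.
by rewrite addr_ge0 ?(mulr_ge0 s_ge0 mid) // addr_ge0 ?tp // mulr_ge0 ?exprn_ge0 ?tp.
Qed.

Lemma tp2_prod_nonpos_roots (c : K) (s : seq K) : 0 <= c ->
    (forall r, r \in s -> r <= 0) ->
  (forall i, 0 <= (c *: \prod_(r <- s) ('X - r%:P))`_i) /\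
  tp2 (nth 0 (c *: \prod_(r <- s) ('X - r%:P))).
Proof.
move=> c_ge0; elim: s => [|r s IHs] s_le0.
  rewrite big_nil; split=> [i|i j _]; rewrite !coefZ !coef1.
    by rewrite mulr_ge0 ?ler0n.
  by rewrite !mulr0.
have [p_ge0 p_tp2] := IHs (fun q qs => s_le0 q (@mem_behead _ (r :: s) q qs)).
rewrite big_cons scalerAr; apply: tp2_mulXsubC => //.
by apply: s_le0; rewrite inE eqxx.
Qed.
End LogConcave.

Lemma tp2_nonpos_roots (C : numClosedFieldType) (p : {poly C}) :
    0 < p.[0] -> (forall r, root p r -> r <= 0) ->
  (forall i, 0 <= p`_i) /\ tp2 (nth 0 p).
Proof.
move=> p0_gt0 p_roots; have [s Dp] := closed_field_poly_normal p.
have pn0 : lead_coef p != 0.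
  by rewrite lead_coef_eq0; apply: contraTneq p0_gt0 => ->; rewrite horner0 ltxx.
have s_roots r : r \in s -> r <= 0.
  by move=> rs; apply: p_roots; rewrite Dp rootZ // root_prod_XsubC.
rewrite Dp; apply: tp2_prod_nonpos_roots => //.
move: p0_gt0; rewrite Dp hornerZ lead_coefZ lead_coef_prod_XsubC mulr1.
rewrite horner_prod => p0_gt0.
have q_ge0 : 0 <= \prod_(r <- s) ('X - r%:P).[0].
  rewrite big_seq prodr_ge0 // => r rs.
  by rewrite hornerXsubC sub0r oppr_ge0 s_roots.
have q_gt0 : 0 < \prod_(r <- s) ('X - r%:P).[0].
  by rewrite lt_def q_ge0 andbT; apply: contraTneq p0_gt0 => ->; rewrite mulr0 ltxx.
by apply: ltW; rewrite -(pmulr_lgt0 _ q_gt0).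
Qed.

Section Real.
Variable R : realType.

Lemma tp2_log_concave d (p : {poly R}) : tp2 (nth 0 p) -> log_concave d p.
Proof. by move=> p_tp2 [|i] // _; rewrite expr2 p_tp2. Qed.

(** Once a strict descent a_(j+1) < a_j has occurred, a later ascent
    a_i < a_(i+1) would give a_(j+1) a_i < a_j a_(i+1),
    against [tp2].  The mode is the first
    descent, or d if there is none. *)
Lemma tp2_unimodal d (p : {poly R}) :
  (forall i, 0 <= p`_i) -> tp2 (nth 0 p) -> unimodal d p.
Proof.
move=> p_ge0 p_tp2.
have exj : exists j, (j == d) || (p`_j.+1 < p`_j) by exists d; rewrite eqxx.
case: (ex_minnP exj) => j jP j_min; exists j; first by apply: j_min; rewrite eqxx.
split=> [i lt_ij | i /andP[le_ji lt_id]].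
  rewrite leNgt; apply: contraL lt_ij => desc.
  by rewrite -leqNgt j_min // desc orbT.
have {jP} desc : p`_j.+1 < p`_j.
  by move: jP; case: eqP => // ej; move: (leq_ltn_trans le_ji lt_id); rewrite ej ltnn.
rewrite leNgt; apply/negP => asc.
have lt_ji : (j < i)%N.
  by rewrite ltn_neqAle le_ji andbT; apply: contraTneq desc => ->; rewrite -leNgt ltW.
case: i => // i in asc lt_ji lt_id le_ji *.
have := p_tp2 j i lt_ji; rewrite leNgt => /negP; apply.
have aj_gt0 : 0 < p`_j by apply: le_lt_trans desc.
apply: le_lt_trans (_ : p`_j * p`_i.+1 < _); first by rewrite ler_wpM2r // ltW.
by rewrite ltr_pM2l.
Qed.
End Real.

Theorem theorem4p1 (R : realType) (n d : nat) (D : {set {set 'I_n}})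
    (D_complex : simplicial_complex D)
    (D_dim : complex_dim D = d%:Z - 1)
    (h_ge0 : forall i : nat, (i <= d)%N -> 0 <= hvec D i) :
  real_rooted (hpoly R (interval_subdivision D)) /\
  log_concave d (hpoly R (interval_subdivision D)) /\
  unimodal d (hpoly R (interval_subdivision D)).
Proof.
have rD : rank D = d by move/addIr: D_dim => [].
have {}h_ge0 i : (i <= rank D)%N -> 0 <= hvec D i by rewrite rD; apply: h_ge0.
set p := hpoly _ _.
have pC : map_poly (real_complex R) p = hpoly_interval D (complex R).
  rewrite /p /hpoly rank_interval_subdivision // rmorph_sum.
  by apply: eq_bigr => k _; rewrite /= map_polyZ map_polyXn rmorph_int.
have p_roots z : root (map_poly (real_complex R) p) z -> z <= 0.
  by rewrite pC; apply: hpoly_interval_roots.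
have p0_gt0 : 0 < (map_poly (real_complex R) p).[0].
  rewrite pC horner_sum big_ord_recl hornerZ hornerXn mulr1 hvec0; last first.
    exact: interval_subdivision_complex.
  by rewrite big1 ?addr0 ?ltr01 // => k _; rewrite hornerZ hornerXn expr0n mulr0.
have [pC_ge0 pC_tp2] := tp2_nonpos_roots p0_gt0 p_roots.
have p_ge0 i : 0 <= p`_i by rewrite -lecR; move: (pC_ge0 i); rewrite coef_map.
have p_tp2 : tp2 (nth 0 p).
  by move=> i j /pC_tp2; rewrite !coef_map /= -!rmorphM /= lecR.
split; first by move=> z /p_roots/ler0_real.
by split; [apply: tp2_log_concave | apply: tp2_unimodal].
Qed.
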